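(* In the space-time random feature method (ST-RFM) setting described in the context, let $u_e$ be the exact solution of the time-dependent problem, let $u_M^S$ and $\hat u^S$ be the functions with coefficient vectors $\boldsymbol{u}^S$ (exact solution of the ST-RFM least-squares problem) and $\hat{\boldsymbol{u}}^S$ (numerical solution, with error $\delta u$ in the solution of the least-squares problem), respectively. Given $\epsilon>0$, assume that $$\|u_M^S(\boldsymbol{x},t)-u_e(\boldsymbol{x},t)\|_{L^2(\Omega\times[t_n,t_{n+1}])}\le\epsilon,\qquad\forall\, n=0,\dots,N_t-1.$$ Then there exist $N\in\mathbb{N}^+$ and $\alpha>0$ such that, when $N_t>N$, $$\mathbb{E}_{\delta u}\big[\|\hat u^S(\boldsymbol{x},t)-u_e(\boldsymbol{x},t)\|_{L^2}\big]\ \le\ \alpha\,\delta\,\sqrt{N_t}+\epsilon\sqrt{N_t},$$ where the $L^2$ norm is over $\Omega\times[0,T]$.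
   Context: Problem. $\mathcal{L}u=f$ on $\Omega\times[0,T]$, with boundary condition $\mathcal{B}u=g$ on $\partial\Omega\times[0,T]$ and initial condition $u(\cdot,0)=h$; $u$ is scalar, $\mathcal{L}$ is a linear differential operator, $\Omega\subset\mathbb{R}^{d_x}$ is compact. Approximation. $[0,T]$ is divided into $N_t$ time subdomains $[t_{i-1},t_i)$, $i=1,\dots,N_t$, with $t_i=iT/N_t$; there is one spatial subdomain. On subdomain $i$ there are $J_n$ random features $\phi_{i,j}(\boldsymbol{x},t)$, $j=1,\dots,J_n$, of the form $\sigma((\boldsymbol{k}^{x}_{i,j})^\top l(\boldsymbol{x})+k^t_{i,j}l_i(t)+b_{i,j})$ or $\sigma((\boldsymbol{k}^{x}_{i,j})^\top l(\boldsymbol{x})+b^x_{i,j})\,\sigma(k^t_{i,j}l_i(t)+b^t_{i,j})$ with fixed parameters, where $l$ is an affine map of $\Omega$ into $[-1,1]^{d_x}$ and $l_i$ is the affine map of $[t_{i-1},t_i]$ onto $[-1,1]$. The function with coefficient vector $\boldsymbol{u}=(\boldsymbol{u}_1,\dots,\boldsymbol{u}_{N_t})$, $\boldsymbol{u}_i\in\mathbb{R}^{J_n}$, is $u_M(\boldsymbol{x},t)=\sum_{i=1}^{N_t}\mathbf{1}_{[t_{i-1},t_i)}(t)\sum_{j=1}^{J_n}u_{i,j}\phi_{i,j}(\boldsymbol{x},t)$. Matrices. Let $\boldsymbol{x}_{i,1},\dots,\boldsymbol{x}_{i,Q_x}\in\Omega$ and $t_{i-1}=t_{i,0}<t_{i,1}<\dots<t_{i,Q_t}=t_i$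 be collocation points in subdomain $i$. Put $\mathbf{\Phi}_i(t)=(\phi_{i,j}(\boldsymbol{x}_{i,q},t))_{q,j}\in\mathbb{R}^{Q_x\times J_n}$, $\mathbf{\Phi}_{i,0}=\mathbf{\Phi}_i(t_{i,0})$, $\mathbf{\Phi}_{i,1}=\mathbf{\Phi}_i(t_{i,Q_t})$, $\mathbf{L}_i(t)=(\mathcal{L}\phi_{i,j}(\boldsymbol{x}_{i,q},t))_{q,j}$, $\mathbf{L}_i=[\mathbf{L}_i(t_{i,0})^\top,\dots,\mathbf{L}_i(t_{i,Q_t-1})^\top]^\top$, $\tilde{\mathbf{A}}_i=[\mathbf{\Phi}_{i,0}^\top,\mathbf{L}_i^\top]^\top$, $\boldsymbol{h}=(h(\boldsymbol{x}_{1,q}))_q$, and let $\boldsymbol{f}_i$ be the vector of values of $f$ at $(\boldsymbol{x}_{i,q},t_{i,j})$, $0\le j\le Q_t-1$, ordered as the rows of $\mathbf{L}_i$. All $\tilde{\mathbf{A}}_i^\top\tilde{\mathbf{A}}_i$ are invertible. ST-RFM. $\boldsymbol{u}^S\in\mathbb{R}^{N_tJ_n}$ is the minimizer of $\|\mathbf{A}\boldsymbol{u}-\boldsymbol{b}\|^2$, where $\mathbf{A}\boldsymbol{u}-\boldsymbol{b}$ is the stacked vector with blocks $\mathbf{\Phi}_{1,0}\boldsymbol{u}_1-\boldsymbol{h}$; $\mathbf{L}_i\boldsymbol{u}_i-\boldsymbol{f}_i$ for $1\le i\le N_t$; and $\mathbf{\Phi}_{i,0}\boldsymbol{u}_i-\mathbf{\Phi}_{i-1,1}\boldsymbol{u}_{i-1}$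 for $2\le i\le N_t$. Standing assumptions. The random features (in local coordinates of the time subdomains) are the same in all subdomains, so that all the matrices $\mathbf{B}_i=(\tilde{\mathbf{A}}_i^\top\tilde{\mathbf{A}}_i)^{-1}\mathbf{\Phi}_{i,0}^\top\mathbf{\Phi}_{i-1,1}$ equal one matrix $\mathbf{B}\in\mathbb{R}^{J_n\times J_n}$; the subdomain length $T/N_t$, the features and $\mathbf{B}$ do not depend on $N_t$. $\mathbf{B}$ is diagonalizable, with eigenvectors $\boldsymbol{b}_1,\dots,\boldsymbol{b}_{J_n}$ forming an orthonormal (unitary) basis. The numerical solution $\hat{\boldsymbol{u}}^S=(\hat{\boldsymbol{u}}^S_i)_i$ satisfies $\hat{\boldsymbol{u}}^S_i-\boldsymbol{u}^S_i=\sum_{k=1}^{J_n}\delta u_{k,i}\boldsymbol{b}_k$ for $i=1,\dots,N_t$, where the $\delta u_{k,i}$ are i.i.d. random variables with $\mathbb{E}[\delta u_{k,i}]=0$, $\mathbb{E}[|\delta u_{k,i}|]=\mu>0$, $\mathbb{E}[(\delta u_{k,i})^2]=\delta^2>0$ (law independent of $N_t$). $\mathbb{E}_{\delta u}$ is the expectation over these perturbations. *)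

(* Defs.v *)
From Stdlib Require List.
From HB Require Import structures.
From mathcomp Require Import all_boot all_order all_algebra.
From mathcomp Require Import all_classical all_reals all_analysis.
From mathcomp Require Import complex.
Import Order.TTheory GRing.Theory Num.Theory.
Import numFieldNormedType.Exports.

Set Implicit Arguments.
Unset Strict Implicit.
Unset Printing Implicit Defensive.

Local Open Scope classical_set_scope.
Local Open Scope ring_scope.

Section borel_rV.
Context (R : realType) (n : nat).

Let coors : 'I_n -> 'rV[R]_n -> R := fun i x => x ord0 i.

Let rV_set0 : g_sigma_preimage coors set0.
Proof. exact: sigma_algebra0. Qed.

Let rV_setC A : g_sigma_preimage coors A -> g_sigma_preimage coors (~` A).
Proof. exact: sigma_algebraC. Qed.

Let rV_bigcup (F : (set 'rV[R]_n)^nat) :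
  (forall i, g_sigma_preimage coors (F i)) ->
  g_sigma_preimage coors (\bigcup_i (F i)).
Proof. exact: sigma_algebra_bigcup. Qed.

(* The product sigma-algebra of the Borel sigma-algebras of the coordinates. *)
HB.instance Definition _ :=
  @isMeasurable.Build (measure_tuple_display R.-ocitv.-measurable.-sigma)
    'rV[R]_n (g_sigma_preimage coors) rV_set0 rV_setC rV_bigcup.

Lemma measurable_coord (i : 'I_n) :
  measurable_fun [set: 'rV[R]_n] (fun x : 'rV[R]_n => x ord0 i).
Proof.
move=> _ Y mY; rewrite setTI; apply: sub_sigma_algebra => /=.
rewrite -bigcup_seq/=; exists i => /=; first by rewrite mem_index_enum.
by exists Y => //; rewrite setTI.
Qed.

Lemma measurable_fun_rV d (T : measurableType d) (f : T -> 'rV[R]_n) :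
  (forall i, measurable_fun [set: T] (fun x => f x ord0 i)) ->
  measurable_fun [set: T] f.
Proof.
move=> mf; apply: (@measurability _ _ _ _ _ _
  (\big[setU/set0]_(i < n) preimage_set_system setT (coors i) measurable)) => //.
move=> _ [A + <-]; rewrite -bigcup_seq => -[/= i _ [B mB <-]].
by rewrite (_ : _ `&` _ = setT `&` (fun x => f x ord0 i) @^-1` B);
  [exact: mf|rewrite !setTI].
Qed.

End borel_rV.

Definition rV_cons (R : realType) (n : nat) (p : 'rV[R]_n * R) : 'rV[R]_n.+1 :=
  \row_i (if unlift ord0 i is Some j then p.1 ord0 j else p.2).

Lemma measurable_rV_cons (R : realType) (n : nat) :
  measurable_fun [set: 'rV[R]_n * R] (@rV_cons R n).
Proof.
apply: measurable_fun_rV => i; case: (unliftP ord0 i) => [j|] ->.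
  have -> : (fun p => @rV_cons R n p ord0 (lift ord0 j)) =
      (fun x : 'rV[R]_n => x ord0 j) \o fst.
    by apply/funext => p; rewrite /= mxE liftK.
  exact: (measurableT_comp (measurable_coord j) measurable_fst).
have -> : (fun p => @rV_cons R n p ord0 ord0) = snd.
  by apply/funext => p; rewrite mxE unlift_none.
exact: measurable_snd.
Qed.

Section lebesgue_rV_succ.
Context (R : realType) (n : nat).
Variable m : {measure set 'rV[R]_n -> \bar R}.

Definition lebesgue_rV_succ : set 'rV[R]_n.+1 -> \bar R :=
  pushforward (m \x (@lebesgue_measure R))%E (@rV_cons R n).

Let mcons := @measurable_rV_cons R n.

Let succ0 : lebesgue_rV_succ set0 = 0%E.
Proof. by rewrite /lebesgue_rV_succ /pushforward preimage_set0 measure0. Qed.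

Let succ_ge0 A : (0 <= lebesgue_rV_succ A)%E.
Proof. exact: measure_ge0. Qed.

Let succ_sigma_additive : semi_sigma_additive lebesgue_rV_succ.
Proof. exact: (@measure_semi_sigma_additive _ _ _ (pushforward _ _)). Qed.

HB.instance Definition _ := isMeasure.Build _ _ _ lebesgue_rV_succ
  succ0 succ_ge0 succ_sigma_additive.

End lebesgue_rV_succ.

Fixpoint lebesgue_rV (R : realType) (n : nat) :
    {measure set 'rV[R]_n -> \bar R} :=
  match n with
  | 0 => @dirac _ 'rV[R]_0 0 R
  | n'.+1 => lebesgue_rV_succ (lebesgue_rV R n')
  end.

Definition lebesgue_spacetime (R : realType) (d : nat) :
    {measure set ('rV[R]_d * measurableTypeR R) -> \bar R} :=
  (lebesgue_rV R d \x (@lebesgue_measure R))%E.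

(* Complex-valued because the eigenvectors of a real normal matrix, hence the
   perturbed coefficients, may be complex. *)
Definition L2norm (R : realType) (d : nat) (D : set ('rV[R]_d * R))
    (F : 'rV[R]_d * R -> R[i]) : \bar R :=
  Lnorm (lebesgue_spacetime R d) 2%:E ((fun z => (Normc.normc (F z))%:E) \_ D).

Section diffop.
Context (R : realType) (d : nat).
Implicit Types (f : 'rV[R]_d * R -> R) (z : 'rV[R]_d * R).

(* [Some k] is the k-th spatial direction, [None] the time direction. *)
Definition pdir (a : option 'I_d) : 'rV[R]_d * R :=
  if a is Some k then (delta_mx ord0 k, 0) else (0, 1).

Fixpoint pderiv (s : seq (option 'I_d)) f : 'rV[R]_d * R -> R :=
  if s is a :: s' then 'D_(pdir a) (pderiv s' f) else f.

Fixpoint pderivable (s : seq (option 'I_d)) f z : Prop :=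
  if s is a :: s' then
    (\forall z' \near z, pderivable s' f z') /\
    derivable (pderiv s' f) z (pdir a)
  else True.

(* [:: (c_1, s_1); ...] stands for the operator
   u |-> c_1 * pderiv s_1 u + ... with variable coefficients c_m. *)
Definition diffop := seq (('rV[R]_d * R -> R) * seq (option 'I_d)).

Definition diffop_app (L : diffop) f z : R :=
  \sum_(m <- L) m.1 z * pderiv m.2 f z.

Definition diffop_defined (L : diffop) f z : Prop :=
  List.Forall (fun m => pderivable m.2 f z) L.

End diffop.

(* The data live on all times t >= 0: the final time T grows with the number of
   time subdomains. Nothing is assumed on the boundary operator. *)
Record problem (R : realType) (d : nat) := Problem {
  dom : set 'rV[R]_d;
  lop : diffop R d;
  bop : ('rV[R]_d * R -> R) -> 'rV[R]_d * R -> R;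
  rhs : 'rV[R]_d * R -> R;
  bdata : 'rV[R]_d * R -> R;
  idata : 'rV[R]_d -> R }.

Definition cylinder (R : realType) (d : nat) (pb : problem R d) (t0 t1 : R) :
    set ('rV[R]_d * R) := dom pb `*` `[t0, t1].

(* The equation is imposed where two-sided derivatives make sense, i.e. at
   interior points; measurability gives a meaning to the L2 errors. *)
Definition exact_solution (R : realType) (d : nat) (pb : problem R d) (T : R)
    (u : 'rV[R]_d * R -> R) : Prop :=
  [/\ measurable_fun (cylinder pb 0 T) u,
      forall x t, (dom pb)° x -> 0 < t < T ->
        diffop_defined (lop pb) u (x, t) /\
        diffop_app (lop pb) u (x, t) = rhs pb (x, t),
      forall x t, (closure (dom pb) `\` (dom pb)°) x -> 0 <= t <= T ->
        bop pb u (x, t) = bdata pb (x, t) &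
      forall x, dom pb x -> u (x, 0) = idata pb x].

(* [Joint kx kt b] is sigma(kx . l(x) + kt l_i(t) + b) and
   [Separable kx bx kt bt] is sigma(kx . l(x) + bx) sigma(kt l_i(t) + bt). *)
Inductive feature (R : realType) (d : nat) :=
  | Joint of 'rV[R]_d & R & R
  | Separable of 'rV[R]_d & R & R & R.

(* Parameters of the features, shared by all time subdomains;
   the map l is x |-> x *m lmat + lvec, and dt is the subdomain length. *)
Record rfm (R : realType) (d J : nat) := RFM {
  activation : R -> R;
  feat : 'I_J -> feature R d;
  lmat : 'M[R]_d;
  lvec : 'rV[R]_d;
  dt : R }.

(* Time subdomains are numbered from 0: subdomain i is [i dt, (i + 1) dt). *)
Section features.
Context (R : realType) (d J : nat) (M : rfm R d J).

Definition tnode (i : nat) : R := i%:R * dt M.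

Definition lspace (x : 'rV[R]_d) : 'rV[R]_d := x *m lmat M + lvec M.

Definition ltime (i : nat) (t : R) : R := 2 * (t - tnode i) / dt M - 1.

Definition dotp (k y : 'rV[R]_d) : R := \sum_j k ord0 j * y ord0 j.

Definition feature_val (F : feature R d) (y : 'rV[R]_d) (s : R) : R :=
  match F with
  | Joint kx kt b => activation M (dotp kx y + kt * s + b)
  | Separable kx bx kt bt => activation M (dotp kx y + bx) * activation M (kt * s + bt)
  end.

Definition phi (i : nat) (j : 'I_J) (z : 'rV[R]_d * R) : R :=
  feature_val (feat M j) (lspace z.1) (ltime i z.2).

Definition rfm_fun (Nt : nat) (u : nat -> 'cV[R[i]]_J) (z : 'rV[R]_d * R) : R[i] :=
  \sum_(i < Nt) (\1_(`[tnode i, tnode i.+1[) z.2)%:C%C *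
    \sum_(j < J) u i j ord0 * (phi i j z)%:C%C.

End features.

(* Points x_{i,q} and times t_{i,0} < ... < t_{i,Qt}. *)
Record collocation (R : realType) (d Qx : nat) := Collocation {
  cx : nat -> 'I_Qx -> 'rV[R]_d;
  ct : nat -> nat -> R }.

Definition collocation_ok (R : realType) (d J Qx : nat) (dom : set 'rV[R]_d)
    (M : rfm R d J) (Nt Qt : nat) (c : collocation R d Qx) : Prop :=
  forall i, (i < Nt)%N ->
    [/\ forall q, dom (cx c i q),
        ct c i 0 = tnode M i,
        ct c i Qt = tnode M i.+1 &
        forall k, (k < Qt)%N -> ct c i k < ct c i k.+1].

Section matrices.
Context (R : realType) (d J Qx : nat).
Variables (pb : problem R d) (M : rfm R d J) (Nt Qt : nat).
Variable c : collocation R d Qx.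

Definition Phi (i : nat) (t : R) : 'M[R]_(Qx, J) :=
  \matrix_(q, j) phi M i j (cx c i q, t).
Definition Phi0 (i : nat) := Phi i (ct c i 0).
Definition Phi1 (i : nat) := Phi i (ct c i Qt).

Definition Lmx_at (i : nat) (t : R) : 'M[R]_(Qx, J) :=
  \matrix_(q, j) diffop_app (lop pb) (phi M i j) (cx c i q, t).
Definition Lmx (i : nat) : 'M[R]_(\sum_(k < Qt) Qx, J) :=
  \mxcol_(k < Qt) Lmx_at i (ct c i k).
Definition fvec (i : nat) : 'cV[R]_(\sum_(k < Qt) Qx) :=
  \mxcol_(k < Qt) \col_q rhs pb (cx c i q, ct c i k).
Definition hvec : 'cV[R]_Qx := \col_q idata pb (cx c 0 q).

Definition Atilde (i : nat) : 'M[R]_(Qx + \sum_(k < Qt) Qx, J) :=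
  col_mx (Phi0 i) (Lmx i).

Definition Bmx (i : nat) : 'M[R]_J :=
  invmx ((Atilde i)^T *m Atilde i) *m (Phi0 i)^T *m Phi1 i.-1.

(* A u - b. A coefficient vector in R^(Nt J) is a family u of blocks, of which
   only u 0, ..., u Nt.-1 matter. *)
Definition residual (u : nat -> 'cV[R]_J) :=
  col_mx (col_mx (Phi0 0 *m u 0%N - hvec)
                 (\mxcol_(i < Nt) (Lmx i *m u i - fvec i)))
         (\mxcol_(i < Nt.-1) (Phi0 i.+1 *m u i.+1 - Phi1 i *m u i)).

Definition sqnorm (m : nat) (v : 'cV[R]_m) : R := \sum_i v i ord0 ^+ 2.

Definition strfm_minimizer (u : nat -> 'cV[R]_J) : Prop :=
  forall v : nat -> 'cV[R]_J, sqnorm (residual u) <= sqnorm (residual v).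

End matrices.

Definition unitary_eigenbasis (R : realType) (J : nat) (B : 'M[R]_J)
    (b : 'I_J -> 'cV[R[i]]_J) : Prop :=
  (\matrix_(k, j) b k j ord0) \is unitarymx /\
  forall k, exists lam : R[i], map_mx (real_complex R) B *m b k = lam *: b k.

Section iid.
Context d (W : measurableType d) (R : realType) (P : probability W R).
Context (I : finType) (X : I -> {RV P >-> R}).

Definition mutually_independent : Prop :=
  forall (S : {set I}) (A : I -> set R), (forall i, measurable (A i)) ->
    P (\bigcap_(i in [set` S]) (X i @^-1` A i)) =
    (\prod_(i in S) P (X i @^-1` A i))%E.

Definition iid (nu : probability R R) : Prop :=
  mutually_independent /\
  forall i (A : set R), measurable A -> distribution P (X i) A = nu A.

End iid.

(* Main.v *)
Require Import Defs.
From HB Require Import structures.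
From mathcomp Require Import all_boot all_order all_algebra.
From mathcomp Require Import all_classical all_reals all_analysis.
From mathcomp Require Import complex.
From mathcomp Require Import measurable_realfun lra ring.
Import Order.TTheory GRing.Theory Num.Theory.
Import numFieldNormedType.Exports.

Set Implicit Arguments.
Unset Strict Implicit.
Unset Printing Implicit Defensive.

Local Open Scope classical_set_scope.
Local Open Scope ring_scope.

(* Splitting uhat - ue = (uhat - uS) + (uS - ue), the second term has L2 norm at
   most eps sqrt Nt because its square is at most eps ^ 2 on each of the Nt
   slabs. For the first one, the features are bounded on a slab uniformly in the
   slab, since they coincide in local coordinates and the parameters range over a
   compact set; hence on slab i it is pointwise at most a constant times
   sqrt (sum_k du_(k,i) ^ 2), and its squared L2 norm is at most a constant times
   sum_(k,i) du_(k,i) ^ 2, whose expectation is J Nt delta ^ 2. The integral of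
   any nonnegative function is the supremum of the integrals of the simple
   functions below it; both estimates are made on those minorants, which avoids
   measurability of the integrands in space-time and in the random parameter. *)

(** * Upper bounds for integrals of nonmeasurable functions *)

Section lower_integral.
Context d (T : measurableType d) (R : realType).
Variable mu : {measure set T -> \bar R}.
Local Open Scope ereal_scope.

Import HBNNSimple.

Lemma ge0_integral_le_minorant (f : T -> \bar R) (c : \bar R) :
  (forall x, 0 <= f x) ->
  (forall h : T -> R, measurable_fun [set: T] h -> (forall x, (0 <= h x)%R) ->
    (forall x, (h x)%:E <= f x) -> \int[mu]_x (h x)%:E <= c) ->
  \int[mu]_x f x <= c.
Proof.
move=> f0 hc; rewrite ge0_integralTE//; apply: ge_ereal_sup => _ [h hf <-].
by rewrite -integralT_nnsfun hc.
Qed.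

(* Unlike [ge0_le_integral], no measurability: the integral of a nonnegative
   function is a supremum over the simple functions below it. *)
Lemma le_integral_nonmeasurable (f g : T -> \bar R) :
  (forall x, 0 <= f x) -> (forall x, f x <= g x) ->
  \int[mu]_x f x <= \int[mu]_x g x.
Proof.
move=> f0 fg; rewrite !ge0_integralTE//; last first.
  by move=> x; exact: le_trans (fg x).
apply: le_ereal_sup => _ [h hf <-]; exists h => // x; exact: le_trans (fg x).
Qed.

(* Neither [f] nor [k] is measurable: a measurable minorant [h] of [f] yields
   the measurable minorant [(h - g)^+ / c] of [k]. *)
Lemma le_integral_cover (I : finType) (A : I -> set T) (f g k : T -> R) (c : R) :
  (0 < c)%R -> (forall i, measurable (A i)) ->
  measurable_fun [set: T] g ->
  (forall x, (0 <= f x)%R) -> (forall x, (0 <= g x)%R) ->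
  (forall x, (0 <= k x)%R) ->
  (forall x, (f x <= g x + c * k x)%R) ->
  (forall x, k x != 0%R -> exists i, A i x) ->
  \int[mu]_x (f x)%:E <=
    \int[mu]_x (g x)%:E + c%:E * \sum_i \int[mu]_(x in A i) (k x)%:E.
Proof.
move=> c0 mA mg f0 g0 k0 fgk kA.
apply: ge0_integral_le_minorant => [x|h mh h0 hf]; first by rewrite lee_fin.
pose h' x := (Num.max (h x - g x) 0 / c)%R.
have mh' : measurable_fun [set: T] h'.
  apply: measurable_funM => //; apply: measurable_maxr => //.
  exact: measurable_funB.
have h'0 x : (0 <= h' x)%R by rewrite divr_ge0 ?le_max ?lexx ?orbT ?ltW.
have h'k x : (h' x <= k x)%R.
  rewrite ler_pdivrMr// ge_max mulr_ge0 ?(ltW c0)// andbT lerBlDl mulrC.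
  by have := hf x; rewrite lee_fin => /le_trans; apply.
(* A point lying in several [A i] is counted several times, which is harmless for an upper bound. *)
pose q i := EFin \o (h' \_ (A i)).
have q0 i x : 0 <= q i x.
  by rewrite /q/= lee_fin patchE; case: ifP.
have mq i : measurable_fun [set: T] (q i).
  apply/measurable_EFinP; apply/(measurable_restrictT _ (mA i)).1.
  exact: measurable_funS mh'.
have qk i : \int[mu]_x q i x <= \int[mu]_(x in A i) (k x)%:E.
  rewrite [leRHS]integral_mkcond; apply: le_integral_nonmeasurable => // x.
  by rewrite /q/= !patchE; case: ifP => // _; rewrite lee_fin.
apply: (@le_trans _ _ (\int[mu]_x ((g x)%:E + c%:E * \sum_i q i x))).
  apply: le_integral_nonmeasurable => [x|x]; first by rewrite lee_fin.
  (* Where [k] vanishes, [h <= f <= g] and no piece is required; elsewhere a single piece containing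
     [x] already gives [h <= g + c * h']. *)
  have [k0x|/kA[i Aix]] := eqVneq (k x) 0%R.
    apply: (@le_trans _ _ (g x)%:E).
      apply: le_trans (hf x) _.
      by rewrite lee_fin (le_trans (fgk x))// k0x mulr0 addr0.
    by rewrite leeDl// mule_ge0 ?lee_fin ?(ltW c0)// sume_ge0.
  rewrite (bigD1 i)//= ge0_muleDr ?sume_ge0// addeA.
  rewrite -[leLHS]adde0; apply: leeD; last first.
    by rewrite mule_ge0 ?lee_fin ?(ltW c0)// sume_ge0.
  have -> : q i x = (h' x)%:E by rewrite /q/= patchE mem_set.
  rewrite -EFinM -EFinD lee_fin.
  rewrite /h' mulrCA divff ?gt_eqF// mulr1 -lerBlDl le_max lexx//.
rewrite ge0_integralD//; last 4 first.
- by move=> x _; rewrite lee_fin.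
- exact/measurable_EFinP.
- by move=> x _; rewrite mule_ge0 ?lee_fin ?(ltW c0)// sume_ge0.
- apply: emeasurable_funM => //; exact: emeasurable_sum.
rewrite leeD2l// ge0_integralZl//; last 3 first.
- exact: emeasurable_sum.
- by move=> x _; rewrite sume_ge0.
- by rewrite lee_fin ltW.
rewrite lee_wpmul2l// ?lee_fin ?(ltW c0)// ge0_integral_sum//.
exact: lee_sum.
Qed.

(** Minkowski's inequality in squared form. Young's inequality bounds [(u + v) ^ 2] by [(1 + q / p)
    * u ^ 2 + (1 + p / q) * v ^ 2], and with these weights the bounds [p ^ 2] and [q ^ 2] combine to
    exactly [(p + q) ^ 2]. Only [u] is measurable; [v] is controlled piece by piece. *)
Lemma integral_sqr_triangle (I : finType) (A : I -> set T)
    (f u v : T -> R) (p q : R) :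
  (0 < p)%R -> (0 < q)%R -> (forall i, measurable (A i)) ->
  measurable_fun [set: T] u ->
  (forall x, (0 <= f x)%R) -> (forall x, (f x <= u x + v x)%R) ->
  (forall x, v x != 0%R -> exists i, A i x) ->
  \int[mu]_x ((u x) ^+ 2)%:E <= (p ^+ 2)%:E ->
  \sum_i \int[mu]_(x in A i) ((v x) ^+ 2)%:E <= (q ^+ 2)%:E ->
  \int[mu]_x ((f x) ^+ 2)%:E <= ((p + q) ^+ 2)%:E.
Proof.
move=> p0 q0 mA mu_ f0 fuv vA up vq.
pose a := ((1 + q / p))%R; pose c := (1 + p / q)%R.
have a0 : (0 < a)%R by rewrite addr_gt0// divr_gt0.
have c0 : (0 < c)%R by rewrite addr_gt0// divr_gt0.
have young x : ((f x) ^+ 2 <= a * (u x) ^+ 2 + c * (v x) ^+ 2)%R.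
  apply: (@le_trans _ _ ((u x + v x) ^+ 2)%R).
    by rewrite ler_sqr// nnegrE ?(le_trans (f0 x)).
  rewrite -subr_ge0.
  have -> : (a * u x ^+ 2 + c * v x ^+ 2 - (u x + v x) ^+ 2 =
     (q * u x - p * v x) ^+ 2 / (p * q))%R.
    by rewrite /a /c; field; rewrite !gt_eqF.
  by rewrite divr_ge0 ?sqr_ge0// mulr_ge0// ltW.
have mu2 : measurable_fun [set: T] (fun x => a * u x ^+ 2)%R.
  by apply: measurable_funM => //; exact: measurable_funX.
apply: le_trans (le_integral_cover c0 mA mu2 _ _ _ young _) _ => //.
- by move=> x; exact: sqr_ge0.
- by move=> x; rewrite mulr_ge0 ?sqr_ge0 ?ltW.
- by move=> x; exact: sqr_ge0.
- by move=> x; rewrite sqrf_eq0; exact: vA.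
under eq_integral do rewrite EFinM.
rewrite ge0_integralZl//; last 3 first.
- by apply/measurable_EFinP; exact: measurable_funX.
- by move=> x _; rewrite lee_fin sqr_ge0.
- by rewrite lee_fin ltW.
have -> : ((p + q) ^+ 2)%:E = a%:E * (p ^+ 2)%:E + c%:E * (q ^+ 2)%:E.
  rewrite -!EFinM -EFinD; congr EFin; rewrite /a /c; field.
  by rewrite !gt_eqF.
by rewrite leeD// lee_wpmul2l ?lee_fin ?(ltW a0) ?(ltW c0).
Qed.

End lower_integral.

(** The norm is the square root of the integral by unfolding alone, so [F] and [D] may be
    nonmeasurable and the integral infinite. *)
Lemma L2norm_le (R : realType) (d : nat) (D : set ('rV[R]_d * R))
    (F : 'rV[R]_d * R -> R[i]) (c : R) : 0 <= c ->
  (L2norm D F <= c%:E)%E =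
  (\int[lebesgue_spacetime R d]_(z in D) ((Normc.normc (F z)) ^+ 2)%:E
     <= (c ^+ 2)%:E)%E.
Proof.
move=> c0; set G := (\int[_]_(_ in _) _)%E.
have G0 : (0 <= G)%E by apply: integral_ge0 => z _; rewrite lee_fin sqr_ge0.
have -> : L2norm D F = sqrte G.
  rewrite /L2norm unlock poweR12_sqrt; last first.
    by apply: integral_ge0 => z _; rewrite poweR_ge0.
  congr sqrte; rewrite /G [RHS]integral_mkcond; apply: eq_integral => z _.
  rewrite !patchE; case: ifPn => _; last by rewrite abse0 poweR0r.
  by rewrite abse_EFin poweR_EFin powR_mulrn// real_normK// num_real.
case: G G0 => [r||]//= r0.
by rewrite !lee_fin -[in RHS](sqr_sqrtr (_ : 0 <= r)) ?ler_sqr ?nnegrE ?sqrtr_ge0.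
Qed.

(** * Boxes of finite Lebesgue measure *)

Section box.
Context (R : realType).

(** A measurable set of finite measure that stands in for the spatial domain, of which only
    compactness is given. *)
Definition box (n : nat) (r : R) : set 'rV[R]_n :=
  [set x | forall i, x ord0 i \in `[- r, r]].

Lemma measurable_box n r : measurable (@box n r).
Proof.
have -> : @box n r =
    \bigcap_(i in [set: 'I_n]) ((fun x => x ord0 i) @^-1` `[- r, r]).
  by apply/seteqP; split => x xr i; [move=> _; exact: xr|exact: (xr i I)].
apply: fin_bigcap_measurable => // i _.
by rewrite -[X in measurable X]setTI; exact: measurable_coord.
Qed.

Lemma lebesgue_rV_box n r : (lebesgue_rV R n (@box n r) < +oo)%E.
Proof.
elim: n => [|n IH].
  by rewrite /= diracE; case: (_ \in _); rewrite ltry.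
(* The preimage of the box under [rV_cons] is the product of a lower-dimensional box and an
   interval. *)
have -> : lebesgue_rV R n.+1 (@box n.+1 r) =
    (lebesgue_rV R n \x @lebesgue_measure R)%E (@box n r `*` `[- r, r]).
  rewrite /= /lebesgue_rV_succ /pushforward; congr (_ _).
  apply/seteqP; split => [[x t] /= H|[x t] /= [Hx Ht] i].
    split => [i|]; first by have := H (lift ord0 i); rewrite mxE liftK.
    by have := H ord0; rewrite mxE unlift_none.
  by rewrite mxE; case: unliftP => [j|] _; [exact: Hx|].
rewrite product_measure1E//; last exact: measurable_box.
apply: lte_mul_pinfty => //; first by rewrite ge0_fin_numE.
by rewrite [ltLHS]lebesgue_measure_itv; case: ifP => _; rewrite ?ltry.
Qed.

Lemma compact_sub_box n (K : set 'rV[R]_n) :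
  compact K -> exists r, K `<=` @box n r.
Proof.
move=> /compact_bounded[r [_ Kr]]; exists (r + 1) => x Kx i.
have /(_ _ x Kx) := Kr (r + 1); rewrite ltrDl ltr01 => /(_ isT) xr.
rewrite in_itv/= -ler_norml; apply: le_trans xr.
rewrite [leRHS]mx_normrE.
exact: (le_bigmax 0 (fun ij => `|x ij.1 ij.2|) (ord0, i)).
Qed.
End box.

(** * The modulus of complex numbers *)

Section normc.
Context (R : rcfType).
Implicit Types x y : R[i].

Lemma normc_ge0 x : 0 <= Normc.normc x.
Proof. by case: x => a c; rewrite /= sqrtr_ge0. Qed.

Lemma normc_real (a : R) : Normc.normc a%:C%C = `|a|.
Proof. by rewrite /= expr0n /= addr0 sqrtr_sqr. Qed.

Lemma ler_normcD x y : Normc.normc (x + y) <= Normc.normc x + Normc.normc y.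
Proof. exact: le_normcD. Qed.

Lemma ler_normc_sum (I : Type) (s : seq I) (F : I -> R[i]) :
  Normc.normc (\sum_(i <- s) F i) <= \sum_(i <- s) Normc.normc (F i).
Proof.
elim: s => [|i s IH]; first by rewrite !big_nil Normc.normc0.
by rewrite !big_cons (le_trans (ler_normcD _ _))// lerD2l.
Qed.

End normc.

(** * Bounds on the features and evaluation of the approximation slab by slab *)

Section random_features.
Context (R : realType) (d J : nat) (M : rfm R d J).

Lemma continuous_bounded_segment (f : R -> R) (A : R) : continuous f ->
  exists2 K, 0 <= K & forall s, `|s| <= A -> `|f s| <= K.
Proof.
move=> cf; have cfA : {within `[- A, A], continuous f}.
  exact: continuous_subspaceT.
have [K [_ HK]] :=
  compact_bounded (continuous_compact cfA (@segment_compact R (- A) A)).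
(* [compact_bounded] yields every bound strictly above [K], and [K] itself may be negative. *)
exists (`|K| + 1); first by rewrite addr_ge0.
move=> s sA; apply: (HK (`|K| + 1)).
  by rewrite (le_lt_trans (ler_norm K))// ltrDl.
by exists s => //=; rewrite in_itv/= -ler_norml.
Qed.

(** In local coordinates the arguments of the activation stay in a segment fixed by the parameters,
    on which a continuous function is bounded. *)
Lemma feature_val_bounded (F : feature R d) : continuous (activation M) ->
  exists2 K, 0 <= K & forall (y : 'rV[R]_d) s,
    (forall k, `|y ord0 k| <= 1) -> `|s| <= 1 -> `|feature_val M F y s| <= K.
Proof.
move=> act_cont.
have dotp_le (k y : 'rV[R]_d) : (forall j, `|y ord0 j| <= 1) ->
    `|dotp k y| <= \sum_j `|k ord0 j|.
  move=> y1; rewrite /dotp (le_trans (ler_norm_sum _ _ _))// ler_sum// => j _.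
  by rewrite normrM ler_piMr.
have aff_le (k s b : R) : `|s| <= 1 -> `|k * s + b| <= `|k| + `|b|.
  by move=> s1; rewrite (le_trans (ler_normD _ _))// lerD2r normrM ler_piMr.
case: F => [kx kt b|kx bx kt bt] /=.
  have [K K0 HK] := continuous_bounded_segment
    (\sum_j `|kx ord0 j| + (`|kt| + `|b|)) act_cont.
  exists K => // y s y1 s1; apply: HK.
  by rewrite -addrA (le_trans (ler_normD _ _))// lerD ?dotp_le ?aff_le.
have [K K0 HK] := continuous_bounded_segment
  (\sum_j `|kx ord0 j| + `|bx|) act_cont.
have [L L0 HL] := continuous_bounded_segment (`|kt| + `|bt|) act_cont.
exists (K * L); first exact: mulr_ge0.
move=> y s y1 s1; rewrite normrM ler_pM//; last by rewrite HL ?aff_le.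
by apply: HK; rewrite (le_trans (ler_normD _ _))// lerD ?dotp_le.
Qed.

Hypothesis dt_gt0 : 0 < dt M.

Lemma ltime_le1 i t : tnode M i <= t <= tnode M i.+1 -> `|ltime M i t| <= 1.
Proof.
rewrite /ltime /tnode -[i.+1%:R]natr1 mulrDl mul1r => /andP[it ti].
rewrite ler_norml lerBrDr addNr lerBlDr.
rewrite divr_ge0 ?mulr_ge0 ?subr_ge0 ?(ltW dt_gt0)//=.
by rewrite ler_pdivrMr//; lra.
Qed.

(* The bound does not depend on the time subdomain because the features are
   the same in local coordinates. *)
Lemma phi_bounded (D : set 'rV[R]_d) : continuous (activation M) ->
  (forall x, D x -> forall k, `|lspace M x ord0 k| <= 1) ->
  exists2 K, 0 <= K & forall i j z, D z.1 ->
    tnode M i <= z.2 <= tnode M i.+1 -> `|phi M i j z| <= K.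
Proof.
move=> act_cont HD.
have /choice[K HK] : forall j : 'I_J, exists K, 0 <= K /\
    forall (y : 'rV[R]_d) s, (forall k, `|y ord0 k| <= 1) -> `|s| <= 1 ->
      `|feature_val M (feat M j) y s| <= K.
  move=> j; have [K K0 HK] := feature_val_bounded (feat M j) act_cont.
  by exists K.
(* The sum dominates each of the finitely many bounds. *)
exists (\sum_j K j); first by rewrite sumr_ge0// => j _; have [] := HK j.
move=> i j z Dz zi; rewrite (bigD1 j)//= -[leLHS]addr0 lerD//.
  by apply: (HK j).2; [exact: HD|exact: ltime_le1].
by rewrite sumr_ge0// => l _; have [] := HK l.
Qed.

Lemma tnode_le i j : (tnode M i <= tnode M j) = (i <= j)%N.
Proof. by rewrite /tnode ler_pM2r// ler_nat. Qed.

Lemma tnode_lt i j : (tnode M i < tnode M j) = (i < j)%N.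
Proof. by rewrite /tnode ltr_pM2r// ltr_nat. Qed.

Lemma slab_inj i j t : tnode M i <= t < tnode M i.+1 ->
  tnode M j <= t < tnode M j.+1 -> i = j.
Proof.
move=> /andP[it ti] /andP[jt tj]; apply/eqP.
have := le_lt_trans it tj; have := le_lt_trans jt ti.
by rewrite !tnode_lt !ltnS eqn_leq => -> ->.
Qed.

Lemma slab_exists n t : tnode M 0 <= t < tnode M n ->
  exists i : 'I_n, tnode M i <= t < tnode M i.+1.
Proof.
elim: n => [|n IH] /andP[t0 tn]; first by rewrite ltNge t0 in tn.
have [tn'|tn'] := ltP t (tnode M n).
  have [|i Hi] := IH; first by rewrite t0.
  by exists (widen_ord (leqnSn n) i).
by exists ord_max; rewrite /= tn'.
Qed.

Lemma rfm_fun_slab Nt (u : nat -> 'cV[R[i]]_J) z (i : 'I_Nt) :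
  tnode M i <= z.2 < tnode M i.+1 ->
  rfm_fun M Nt u z = \sum_(j < J) u i j ord0 * (phi M i j z)%:C%C.
Proof.
move=> zi; rewrite /rfm_fun (bigD1 i)//= [X in _ + X]big1 ?addr0 => [|k ki].
  rewrite indicE mem_set; [|by rewrite /= in_itv]. by rewrite mul1r.
rewrite indicE memNset ?mul0r//= in_itv/= => zk.
by move/eqP: ki; apply; apply/val_inj/(slab_inj zk zi).
Qed.

(** The slabs are half-open, so at the final time every indicator vanishes. The cylinder contains
    that time, and there the perturbed and unperturbed functions agree. *)
Lemma rfm_fun_after Nt (u : nat -> 'cV[R[i]]_J) z :
  tnode M Nt <= z.2 -> rfm_fun M Nt u z = 0.
Proof.
move=> Tz; rewrite /rfm_fun big1// => i _; rewrite indicE memNset ?mul0r//=.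
rewrite in_itv/= => /andP[_]; apply/negP; rewrite -leNgt.
by apply: le_trans Tz; rewrite tnode_le.
Qed.

End random_features.

(** * The error for one realization of the perturbations *)

Section perturbation.
Context (R : realType) (d J : nat) (M : rfm R d J) (pb : problem R d).
Variables (b : 'I_J -> 'cV[R[i]]_J) (r K : R).
Hypothesis dt_gt0 : 0 < dt M.
Hypothesis dom_box : dom pb `<=` box r.
Hypothesis K_ge0 : 0 <= K.
Hypothesis phi_K : forall i j z, dom pb z.1 ->
  tnode M i <= z.2 <= tnode M i.+1 -> `|phi M i j z| <= K.

Let beta : R := \sum_k \sum_j Normc.normc (b k j ord0).

(** Factor from the sum of the squared perturbations to the squared L2 norm of their effect: the
    square of a pointwise bound times the measure of a slab over the box. *)
Definition gain : R :=
  (beta * K) ^+ 2 * (fine (lebesgue_rV R d (box r)) * dt M).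

Lemma gain_ge0 : 0 <= gain.
Proof. by rewrite mulr_ge0 ?sqr_ge0// mulr_ge0 ?(ltW dt_gt0)// fine_ge0. Qed.

(** Each [e k] is at most the Euclidean norm of [e]; the triangle inequality then leaves the sum
    [beta] of the moduli of all eigenvector entries. *)
Lemma normc_perturbation (e : 'I_J -> R) (i : nat) z : dom pb z.1 ->
  tnode M i <= z.2 <= tnode M i.+1 ->
  Normc.normc (\sum_j (\sum_k (e k)%:C%C *: b k) j ord0 * (phi M i j z)%:C%C)
    <= beta * K * Num.sqrt (\sum_k e k ^+ 2).
Proof.
move=> Dz zi; set S := \sum_k e k ^+ 2.
have eS k : `|e k| <= Num.sqrt S.
  rewrite -sqrtr_sqr ler_wsqrtr// /S (bigD1 k)//= lerDl.
  by apply: sumr_ge0 => l _; exact: sqr_ge0.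
apply: le_trans (ler_normc_sum _ _) _.
have -> : beta * K * Num.sqrt S =
    \sum_j (\sum_k Num.sqrt S * Normc.normc (b k j ord0)) * K.
  rewrite /beta exchange_big/= -[RHS]mulr_suml.
  under [in RHS]eq_bigr do rewrite -mulr_sumr.
  by rewrite -mulr_sumr; ring.
apply: ler_sum => j _; rewrite Normc.normcM normc_real.
apply: ler_pM; [exact: normc_ge0|exact: normr_ge0| |exact: phi_K].
rewrite summxE; apply: le_trans (ler_normc_sum _ _) _.
apply: ler_sum => k _; rewrite mxE Normc.normcM normc_real.
by rewrite ler_wpM2r// normc_ge0.
Qed.

Lemma measurable_slab (A : set 'rV[R]_d) (i : interval R) : measurable A ->
  measurable (A `*` [set` i] : set ('rV[R]_d * measurableTypeR R)).
Proof. by move=> mA; apply: measurableX => //; exact: measurable_itv. Qed.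

Lemma lebesgue_spacetime_slab i :
  lebesgue_spacetime R d (box r `*` `[tnode M i, tnode M i.+1[) =
  (fine (lebesgue_rV R d (box r)) * dt M)%:E.
Proof.
rewrite [LHS]product_measure1E//; [|exact: measurable_box].
rewrite [X in (_ * X)%E](_ : _ = (dt M)%:E).
  rewrite EFinM fineK// ge0_fin_numE//; exact: lebesgue_rV_box.
rewrite [LHS]lebesgue_measure_itv/= lte_fin tnode_lt// ltnSn -EFinD.
by rewrite /tnode -natr1 mulrDl mul1r addrAC subrr add0r.
Qed.

(** Purely deterministic. [p] is left free, rather than set to a square root, so that it can be
    chosen affine in the sum of squares, whose expectation is known. *)
Lemma L2norm_rfm_le (Nt : nat) (e : 'I_J * 'I_Nt -> R)
    (ue : 'rV[R]_d * R -> R) (uS : nat -> 'cV[R]_J) (uhat : nat -> 'cV[R[i]]_J)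
    (eps p q : R) :
  (0 < Nt)%N -> 0 <= eps -> 0 < p -> 0 < q ->
  (forall i : 'I_Nt, uhat i - map_mx (real_complex R) (uS i) =
    \sum_(k < J) (e (k, i))%:C%C *: b k) ->
  (forall n, (n < Nt)%N ->
    (L2norm (cylinder pb (tnode M n) (tnode M n.+1))
      (fun z => (rfm_fun M Nt (fun i => map_mx (real_complex R) (uS i)) z
                   - (ue z)%:C%C)%R) <= eps%:E)%E) ->
  gain * (\sum_ki e ki ^+ 2) <= p ^+ 2 ->
  eps ^+ 2 *+ Nt <= q ^+ 2 ->
  (L2norm (cylinder pb 0%R (tnode M Nt))
    (fun z => (rfm_fun M Nt uhat z - (ue z)%:C%C)%R) <= (p + q)%:E)%E.
Proof.
move=> Nt0 eps0 p0 q0 uhatE approx hp hq.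
set uSC := fun i => map_mx (real_complex R) (uS i).
have tnode0 : tnode M 0 = 0 by rewrite /tnode mul0r.
pose D := cylinder pb 0 (tnode M Nt).
pose f : 'rV[R]_d * measurableTypeR R -> R :=
  (fun z => Normc.normc (rfm_fun M Nt uhat z - (ue z)%:C%C)) \_ D.
pose v : 'rV[R]_d * measurableTypeR R -> R :=
  (fun z => Normc.normc (rfm_fun M Nt uSC z - (ue z)%:C%C)) \_ D.
pose S (i : 'I_Nt) := \sum_k e (k, i) ^+ 2.
pose B (i : 'I_Nt) : set ('rV[R]_d * measurableTypeR R) :=
  box r `*` `[tnode M i, tnode M i.+1[.
(* Closed slabs, as in [approx]: together they cover the final time too, and their overlaps do no
   harm. *)
pose A (i : 'I_Nt) : set ('rV[R]_d * measurableTypeR R) :=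
  setT `*` `[tnode M i, tnode M i.+1].
have S0 i : 0 <= S i by apply: sumr_ge0 => k _; exact: sqr_ge0.
pose w i := (beta * K) ^+ 2 * S i.
have w0 i : 0 <= w i by rewrite mulr_ge0 ?sqr_ge0.
have mB i : measurable (B i) by apply: measurable_slab; exact: measurable_box.
have mA i : measurable (A i) by apply: measurable_slab.
pose u2 (z : 'rV[R]_d * measurableTypeR R) :=
  (* A step function whose square root dominates the modulus of the perturbation; it is the
     measurable term of the splitting. *)
  \sum_i w i * \1_(B i) z.
have u20 z : 0 <= u2 z.
  by apply: sumr_ge0 => i _; rewrite mulr_ge0 ?w0// indicE.
have mu2 : measurable_fun [set: 'rV[R]_d * measurableTypeR R] u2.
  by apply: measurable_sum => i; exact: measurable_funM.
rewrite L2norm_le; last by rewrite addr_ge0// ltW.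
rewrite integral_mkcond.
rewrite (eq_integral (fun z => (f z ^+ 2)%:E)); last first.
  by move=> z _; rewrite /f !patchE; case: ifP => // _; rewrite expr0n.
apply: (@integral_sqr_triangle _ _ _ _ _ A f (Num.sqrt \o u2) v) => //.
- have ms : measurable_fun [set: R] (@Num.sqrt R).
    by apply: continuous_measurable_fun; exact: sqrt_continuous.
  exact: measurableT_comp.
- by move=> z; rewrite /f patchE; case: ifP => // _; exact: normc_ge0.
- move=> z; rewrite /f /v !patchE; case: ifPn => [|_]; last by rewrite addr0 sqrtr_ge0.
  rewrite inE => -[Dz]; rewrite /= in_itv/= => /andP[z0 zT].
  have [Tz|zT'] := leP (tnode M Nt) z.2.
    by rewrite !rfm_fun_after// lerDr sqrtr_ge0.
  have [|i zi] := @slab_exists _ _ _ M Nt z.2; first by rewrite tnode0 z0.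
  rewrite -[X in Normc.normc X](subrKA (rfm_fun M Nt uSC z)) addrC.
  rewrite [in leLHS]addrC; apply: le_trans (ler_normcD _ _) _; rewrite lerD2r.
  rewrite !(rfm_fun_slab dt_gt0 _ zi) -sumrB.
  have dE j : uhat i j ord0 - uSC i j ord0 =
      (\sum_k (e (k, i))%:C%C *: b k) j ord0.
    by rewrite -uhatE !mxE.
  under eq_bigr do rewrite -mulrBl dE.
  have zi' : tnode M i <= z.2 <= tnode M i.+1.
    by case/andP: zi => -> /ltW.
  apply: le_trans (normc_perturbation (fun k => e (k, i)) Dz zi') _.
  have bK0 : 0 <= beta * K.
    rewrite mulr_ge0// sumr_ge0// => k _; rewrite sumr_ge0// => j _.
    exact: normc_ge0.
  (* [beta * K] goes under the root, to be compared with the [i]-th term of [u2]. *)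
  rewrite -{1}(ger0_norm bK0) -sqrtr_sqr -sqrtrM ?sqr_ge0// ler_wsqrtr//.
  rewrite /u2 (bigD1 i)//= indicE mem_set; last first.
    by split; [exact: dom_box|rewrite /= in_itv].
  rewrite mulr1 lerDl sumr_ge0// => l _.
  by rewrite mulr_ge0 ?w0// indicE.
- move=> z; rewrite /v patchE; case: ifPn => [|_]; last by rewrite eqxx.
  rewrite inE => -[Dz]; rewrite /= in_itv/= => /andP[z0 zT] _.
  have [Tz|zT'] := leP (tnode M Nt) z.2.
    (* The final time lies in the last closed slab. *)
    have lNt : (Nt.-1 < Nt)%N by rewrite prednK.
    exists (Ordinal lNt); split => //=; rewrite in_itv/= prednK// zT andbT.
    by apply: le_trans Tz; rewrite tnode_le// leq_pred.
  have [|i /andP[iz zi]] := @slab_exists _ _ _ M Nt z.2; first by rewrite tnode0 z0.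
  by exists i; split => //=; rewrite in_itv/= iz ltW.
- rewrite (eq_integral (fun z => (u2 z)%:E)); last first.
    by move=> z _; rewrite /= sqr_sqrtr.
  under eq_integral do rewrite -sumEFin.
  rewrite ge0_integral_sum//; last 2 first.
  + move=> i; apply/measurable_EFinP; exact: measurable_funM.
  + by move=> i z _; rewrite lee_fin mulr_ge0 ?w0// indicE.
  have intB i : (\int[lebesgue_spacetime R d]_z
      (w i * \1_(B i) z)%:E =
    (w i * (fine (lebesgue_rV R d (box r)) * dt M))%:E)%E.
    under eq_integral do rewrite EFinM.
    rewrite ge0_integralZl ?lee_fin//; last first.
      by apply/measurable_EFinP; exact: measurable_indic.
    by rewrite integral_indic// setIT lebesgue_spacetime_slab -EFinM.
  under eq_bigr do rewrite intB.
  rewrite sumEFin lee_fin; apply: le_trans hp.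
  (* After exchanging the sums over [k] and [i], the integral of [u2] is exactly [gain] times the
     sum of squares. *)
  rewrite le_eqVlt; apply/predU1P; left.
  rewrite -mulr_suml -mulr_sumr /gain mulrAC; congr (_ * _).
  by rewrite exchange_big pair_bigA/=; apply: eq_bigr => -[].
- apply: (@le_trans _ _ (\sum_(i < Nt) (eps ^+ 2)%:E)%E).
    apply: lee_sum => i _.
    have := approx i (ltn_ord i); rewrite L2norm_le//; apply: le_trans.
    (* On [A i], [v] is either zero or the error of [approx] at a point of the same closed slab of
       the cylinder. *)
    rewrite integral_mkcond [leRHS]integral_mkcond.
    apply: le_integral_nonmeasurable => z.
      by rewrite patchE; case: ifP => // _; rewrite lee_fin sqr_ge0.
    rewrite !patchE; case: ifPn => [|_]; last first.
      by case: ifP => // _; rewrite lee_fin sqr_ge0.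
    rewrite inE => -[_ Az]; rewrite /v patchE; case: ifPn => [|_]; last first.
      by rewrite expr0n; case: ifP => // _; rewrite lee_fin sqr_ge0.
    by rewrite inE => -[Dz _]; rewrite mem_set.
  by rewrite sumEFin lee_fin sumr_const card_ord.
Qed.

End perturbation.

(** * Expectation over the perturbations *)

Theorem theorem2p13 (R : realType) (d J : nat)
  (pb : problem R d) (M : rfm R d J)
  (dom_compact : compact (dom pb))
  (act_cont : continuous (activation M))
  (dt_gt0 : 0 < dt M)
  (lspace_dom : forall x, dom pb x -> forall k, `|lspace M x ord0 k| <= 1)
  (feat_smooth : forall i j x t, dom pb x -> tnode M i <= t <= tnode M i.+1 ->
    diffop_defined (lop pb) (phi M i j) (x, t))
  (B : 'M[R]_J) (b : 'I_J -> 'cV[R[i]]_J)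
  (b_eigen : unitary_eigenbasis B b)
  (nu : probability R R) (mu delta : R)
  (mu_gt0 : 0 < mu) (delta_gt0 : 0 < delta)
  (eps : R) (eps_gt0 : 0 < eps) :
  exists (N : nat) (alpha : R), [/\ (0 < N)%N, 0 < alpha &
  forall (Nt : nat), (N < Nt)%N ->
  forall (Qx Qt : nat) (c : collocation R d Qx)
    (c_ok : collocation_ok (dom pb) M Nt Qt c)
    (Atilde_inv : forall i, (i < Nt)%N ->
      (Atilde pb M Qt c i)^T *m Atilde pb M Qt c i \in unitmx)
    (B_eq : forall i, (0 < i < Nt)%N -> Bmx pb M Qt c i = B)
    (ue : 'rV[R]_d * R -> R)
    (ue_sol : exact_solution pb (tnode M Nt) ue)
    (uS : nat -> 'cV[R]_J)
    (uS_min : strfm_minimizer pb M Nt Qt c uS)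
    (dW : measure_display) (W : measurableType dW) (P : probability W R)
    (du : 'I_J * 'I_Nt -> {RV P >-> R})
    (du_iid : iid du nu)
    (du_mean : forall ki, ('E_P[du ki] = 0)%E)
    (du_abs : forall ki, ('E_P[fun w => `|du ki w|%R] = mu%:E)%E)
    (du_sq : forall ki, ('E_P[fun w => (du ki w ^+ 2)%R] = (delta ^+ 2)%:E)%E)
    (uhat : W -> nat -> 'cV[R[i]]_J)
    (uhat_eq : forall w (i : 'I_Nt), uhat w i - map_mx (real_complex R) (uS i) =
      \sum_(k < J) (du (k, i) w)%:C%C *: b k)
    (approx : forall n, (n < Nt)%N ->
      (L2norm (cylinder pb (tnode M n) (tnode M n.+1))
        (fun z => (rfm_fun M Nt (fun i => map_mx (real_complex R) (uS i)) z
                   - (ue z)%:C%C)%R) <= eps%:E)%E),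
  (\int[P]_w L2norm (cylinder pb 0%R (tnode M Nt))
      (fun z => (rfm_fun M Nt (uhat w) z - (ue z)%:C%C)%R)
    <= (alpha * delta * Num.sqrt Nt%:R + eps * Num.sqrt Nt%:R)%:E)%E].
Proof.
have [r dom_box] := compact_sub_box dom_compact.
have [K K0 phi_K] := phi_bounded dt_gt0 act_cont lspace_dom.
pose g := gain M b r K.
have g0 : 0 <= g by exact: gain_ge0.
(* Adding 1 here, and taking [J.+1] below, keeps the constants positive even if [gain] or [J] is
   zero. *)
pose C := Num.sqrt (g + 1).
have C0 : 0 < C by rewrite sqrtr_gt0 ltr_wpDl.
have J0 : 0 < Num.sqrt J.+1%:R :> R by rewrite sqrtr_gt0 ltr0n.
exists 1%N, (C * Num.sqrt J.+1%:R); split => //; first exact: mulr_gt0.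
move=> Nt Nt1 Qx Qt c c_ok Ainv BE ue ue_sol uS uS_min dW W P du du_iid du_mean
  du_abs du_sq uhat uhatE approx.
have Nt0 : (0 < Nt)%N by exact: ltnW.
have sN0 : 0 < Num.sqrt Nt%:R :> R by rewrite sqrtr_gt0 ltr0n.
(* [a ^ 2] bounds the expectation [J * Nt * delta ^ 2] of [X]; it is also the point where the affine
   bound on [sqrt X] is tangent, which makes the averaged bound at most [C * a]. *)
pose a := delta * Num.sqrt J.+1%:R * Num.sqrt Nt%:R.
have a0 : 0 < a by rewrite !mulr_gt0.
pose X w := \sum_ki du ki w ^+ 2.
have X0 w : 0 <= X w by apply: sumr_ge0 => ki _; exact: sqr_ge0.
pose q := eps * Num.sqrt Nt%:R.
have q0 : 0 < q by exact: mulr_gt0.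
(* [sqrt X <= X / (2 a) + a / 2] stands in for Jensen's inequality. *)
pose p w := C * (X w / (2 * a) + a / 2).
have p0 w : 0 < p w.
  rewrite mulr_gt0// ltr_wpDl ?divr_gt0// divr_ge0// mulr_ge0// ltW//.
have pX w : g * X w <= p w ^+ 2.
  rewrite /p exprMn sqr_sqrtr ?addr_ge0// ler_pM// ?lerDl//.
  (* The arithmetic-geometric mean inequality for [X w / (2 * a)] and [a / 2], whose product is
     [X w / 4]. *)
  rewrite -subr_ge0 (_ : _ - _ = (X w / (2 * a) - a / 2) ^+ 2) ?sqr_ge0//.
  by field; rewrite gt_eqF.
have pw w : (L2norm (cylinder pb 0%R (tnode M Nt))
    (fun z => (rfm_fun M Nt (uhat w) z - (ue z)%:C%C)%R) <= (p w + q)%:E)%E.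
  apply: (L2norm_rfm_le dt_gt0 dom_box K0 phi_K Nt0 (ltW eps_gt0) (p0 w) q0
    (uhatE w) approx (pX w)).
  by rewrite exprMn sqr_sqrtr// mulr_natr.
have mX : measurable_fun [set: W] X.
  by apply: measurable_sum => ki; exact: measurable_funX.
have EX : (\int[P]_w (X w)%:E <= (a ^+ 2)%:E)%E.
  under eq_integral do rewrite -sumEFin.
  rewrite ge0_integral_sum//; last 2 first.
  - by move=> ki; apply/measurable_EFinP; exact: measurable_funX.
  - by move=> ki w _; rewrite lee_fin sqr_ge0.
  under eq_bigr => ki _.
    have := du_sq ki; rewrite unlock => ->; over.
  rewrite sumEFin lee_fin sumr_const card_prod !card_ord.
  rewrite /a !exprMn !sqr_sqrtr// -[delta ^+ 2 *+ _]mulr_natr natrM -mulrA.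
  rewrite ler_wpM2l ?sqr_ge0//.
  by rewrite ler_wpM2r// ler_nat.
(* The L2 norm as a function of [w] may be nonmeasurable; its majorant [p w + q] is measurable. *)
apply: (@le_trans _ _ (\int[P]_w (p w + q)%:E)%E).
  apply: le_integral_nonmeasurable => // w; exact: Lnorm_ge0.
rewrite (eq_integral (fun w => ((C / (2 * a))%:E * (X w)%:E
    + (C * a / 2 + q)%:E)%E)); last first.
  by move=> w _; rewrite -EFinM -EFinD; congr EFin; rewrite /p; field; rewrite gt_eqF.
have Ca0 : 0 <= C / (2 * a) by rewrite divr_ge0 ?mulr_ge0 ?ltW.
have cst0 : 0 <= C * a / 2 + q.
  by rewrite addr_ge0 ?(ltW q0)// divr_ge0// mulr_ge0 ?ltW.
rewrite ge0_integralD//; last 2 first.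
- by move=> w _; rewrite mule_ge0 ?lee_fin.
- by apply: emeasurable_funM => //; exact/measurable_EFinP.
rewrite ge0_integralZl//; last 2 first.
- exact/measurable_EFinP.
- by move=> w _; rewrite lee_fin.
rewrite integral_cst// [X in (_ + _ * X)%E]probability_setT mule1.
apply: (@le_trans _ _ ((C / (2 * a))%:E * (a ^+ 2)%:E + (C * a / 2 + q)%:E)%E).
  by rewrite leeD2r// lee_wpmul2l// lee_fin.
(* The two halves [C / (2 * a) * a ^ 2] and [C * a / 2] add up to [C * a], which is
   [alpha * delta * sqrt Nt]. *)
rewrite -EFinM -EFinD lee_fin le_eqVlt; apply/predU1P; left.
rewrite (_ : C * _ * _ * _ = C * a); last by rewrite /a; ring.
by rewrite -/q; field; rewrite gt_eqF.
Qed.
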